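(* Let $G$ be a discrete lattice-ordered group of dimension $\le1$ and $\pi>0$ in $G$. The following are equivalent: 1. $\pi$ is an irreducible element. 2. $\mathcal C(\pi)=\mathbb Z\pi\simeq(\mathbb Z,\ge0)$. 3. Every $\alpha\in G^+$ can be written in a unique way as $\alpha=n\pi+\alpha_2$ with $n\in\mathbb N$ and $\alpha_2\in G^+$, $\alpha_2\perp\pi$.
   Context: Lattice-ordered groups are abelian, written additively; $G^+=\{x\in G:x\ge0\}$. $G$ is discrete if its order is decidable. $x\perp y$ means $|x|\wedge|y|=0$; $H^\perp=\{x\in G:\forall h\in H,\ x\perp h\}$. For $\gamma\in G$, $\mathcal C(\gamma)=\{\xi\in G:\exists n\in\mathbb N,\ |\xi|\le n|\gamma|\}$ is the solid subgroup generated by $\gamma$. $G=H\boxplus L$ means $G=H\oplus L$ with $H\perp L$. $G$ is of dimension $\le1$ if for every $\xi\in G^+$, $G=\mathcal C(\xi)\boxplus\mathcal C(\xi)^\perp$. An element $\pi>0$ is irreducible if $\pi=\eta+\zeta$ with $\eta,\zeta\in G^+$ implies $\eta=0$ or $\zeta=0$. In item 2, $(\mathbb Z,\ge 0)$ denotes $\mathbb Z$ with its usual order. *)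

(* Defs.v *)
From HB Require Import structures.
From mathcomp Require Import all_boot all_order all_algebra.

Set Implicit Arguments.
Unset Strict Implicit.
Unset Printing Implicit Defensive.

Import Order.TTheory GRing.Theory Num.Theory.
Local Open Scope ring_scope.

(* Abelian lattice-ordered groups.  The relation [<=] is boolean, i.e. the    *)
(* order is decidable, so these are the discrete ones.  Hierarchy Builder     *)
(* rejects a join of [Order.Lattice] and [GRing.Zmodule] declared after       *)
(* [realDomainType], so the meet and join are fields of the mixin and the     *)
(* [latticeType] structure is derived from them.                              *)
HB.mixin Record POrderedZmodule_isLatticeGroup G of Num.POrderedZmodule G := {
  lgmeet : G -> G -> G;
  lgjoin : G -> G -> G;
  lglexI : forall x y z : G, (x <= lgmeet y z) = (x <= y) && (x <= z);
  lgleUx : forall x y z : G, (lgjoin x y <= z) = (x <= z) && (y <= z);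
  lgleD2l : forall z x y : G, x <= y -> z + x <= z + y
}.

#[short(type="lgroupType")]
HB.structure Definition LatticeGroup :=
  { G of POrderedZmodule_isLatticeGroup G & Num.POrderedZmodule G }.

#[non_forgetful_inheritance]
HB.instance Definition _ (G : lgroupType) :=
  Order.POrder_isMeetSemilattice.Build ring_display (LatticeGroup.sort G)
    (@lglexI G).
#[non_forgetful_inheritance]
HB.instance Definition _ (G : lgroupType) :=
  Order.POrder_isJoinSemilattice.Build ring_display (LatticeGroup.sort G)
    (@lgleUx G).

Bind Scope ring_scope with LatticeGroup.sort.

Section LatticeGroupDefs.
Context {G : lgroupType}.
Implicit Types (x y g h l xi eta zeta : G) (H L : G -> Prop).

(* [Num.norm] is not available here: [G] is not a number domain. *)
Definition labs x : G := (x `|` (- x))%O.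

Definition orth x y : Prop := (labs x `&` labs y)%O = 0.

Definition orth_compl H x : Prop := forall h, H h -> orth x h.

Definition solid_gen (gamma : G) xi : Prop :=
  exists n : nat, labs xi <= labs gamma *+ n.

(* Subsets of [G] are [Prop]-valued, since membership in [solid_gen gamma] is *)
(* not decidable in general.                                                  *)
Definition is_subgroup H : Prop :=
  H 0 /\ forall x y, H x -> H y -> H (x - y).

Definition is_direct_sum H L : Prop :=
  [/\ is_subgroup H,
      is_subgroup L,
      forall g, exists h, exists l, [/\ H h, L l & g = h + l]
    & forall x, H x -> L x -> x = 0].

Definition is_orth_sum H L : Prop :=
  is_direct_sum H L /\ forall h l, H h -> L l -> orth h l.

Definition int_multiples (p : G) x : Prop := exists n : int, x = p *~ n.

Definition irreducible_elt (p : G) : Prop :=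
  0 < p /\ forall eta zeta, 0 <= eta -> 0 <= zeta -> p = eta + zeta ->
    eta = 0 \/ zeta = 0.

End LatticeGroupDefs.

Definition dim_le1 (G : lgroupType) : Prop :=
  forall xi : G, 0 <= xi ->
    is_orth_sum (solid_gen xi) (orth_compl (solid_gen xi)).

(* [H], with the operations and the order induced by [G], is isomorphic to    *)
(* [K].  Injectivity of [f] follows from the antisymmetry of [<=]; being an   *)
(* order isomorphism onto [H], [f] also respects meets and joins.             *)
Definition ordered_group_iso (G : lgroupType) (H : G -> Prop)
    (K : Num.POrderedZmodule.type) : Prop :=
  exists f : {additive K -> G},
    {mono f : a b / a <= b} /\ (forall x, H x <-> exists a, x = f a).

(* Main.v *)
(* If [p] is irreducible and [0 <= x <= p *+ n.+1], the splitting             *)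
(* [p = y + (p - y)] with [y] the meet of [x] and [p] gives [y = p] or        *)
(* [y = 0], hence [p <= x] or [x <= p *+ n], so by descent [x] is a multiple  *)
(* of [p].  Dimension at most 1 then decomposes each positive element along   *)
(* [p], and disjointness of the two parts makes both of them positive.        *)
(* Conversely, decomposing [eta] and [zeta] with [p = eta + zeta] and         *)
(* comparing with [p = p *+ 1 + 0] shows that one of them vanishes.           *)
Require Import Defs.
From HB Require Import structures.
From mathcomp Require Import all_boot all_order all_algebra.

Import Order.TTheory GRing.Theory Num.Theory.
Local Open Scope ring_scope.

Section LatticeGroupTheory.
Set Implicit Arguments.
Unset Strict Implicit.
Variable G : lgroupType.
Implicit Types (x y z a b p h l : G).

Lemma lg_leD2l z x y : (z + x <= z + y) = (x <= y).
Proof.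
apply/idP/idP => [/(lgleD2l (- z))|]; last exact: lgleD2l.
by rewrite !addKr.
Qed.

Lemma lg_leD2r z x y : (x + z <= y + z) = (x <= y).
Proof. by rewrite ![_ + z]addrC lg_leD2l. Qed.

Lemma lg_leBlD x y z : (x - y <= z) = (x <= z + y).
Proof. by rewrite -[LHS](lg_leD2r y) subrK. Qed.

Lemma lg_subr_ge0 x y : (0 <= y - x) = (x <= y).
Proof. by rewrite -[LHS](lg_leD2r x) add0r subrK. Qed.

Lemma lg_oppr_le0 x : (- x <= 0) = (0 <= x).
Proof. by rewrite -{1}[- x]add0r lg_leBlD add0r. Qed.

Lemma lg_leDl x y : 0 <= y -> x <= x + y.
Proof. by move=> y0; rewrite -{1}[x]addr0 lg_leD2l. Qed.

Lemma lg_leB x y : 0 <= y -> x - y <= x.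
Proof. by move=> y0; rewrite lg_leBlD lg_leDl. Qed.

Lemma lg_addr_ge0 x y : 0 <= x -> 0 <= y -> 0 <= x + y.
Proof. by move=> x0 /(lg_leDl x); apply: le_trans. Qed.

Lemma lg_mulrn_ge0 x n : 0 <= x -> 0 <= x *+ n.
Proof. by move=> x0; elim: n => // n IH; rewrite mulrS lg_addr_ge0. Qed.

Lemma lg_ler_mulrz p (m n : int) : 0 < p -> (p *~ m <= p *~ n) = (m <= n).
Proof.
move=> p0; rewrite -lg_subr_ge0 -mulrzBr -[RHS]subr_ge0.
case: (n - m) => k; first by rewrite le0z_nat lg_mulrn_ge0 // ltW.
rewrite NegzE mulrNz -lg_oppr_le0 opprK -pmulrn mulrS.
apply/negbTE/negP => pk0.
have := le_trans (lg_leDl p (lg_mulrn_ge0 k (ltW p0))) pk0.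
by rewrite (lt_geF p0).
Qed.

Lemma labs_le x y : (labs x <= y) = (x <= y) && (- x <= y).
Proof. exact: leUx. Qed.

Lemma le_labs x : x <= labs x.
Proof. exact: leUl. Qed.

Lemma leN_labs x : - x <= labs x.
Proof. exact: leUr. Qed.

Lemma labs_ge0_id x : 0 <= x -> labs x = x.
Proof.
move=> x0; apply/le_anti; rewrite le_labs labs_le lexx /= andbT.
by rewrite (le_trans _ x0) ?lg_oppr_le0.
Qed.

Lemma orthC x y : orth x y -> orth y x.
Proof. by rewrite /orth meetC. Qed.

Lemma orth_le0 a b x : orth a b -> x <= labs a -> x <= labs b -> x <= 0.
Proof. by rewrite /orth => <- xa xb; rewrite lexI xa. Qed.

Lemma orth_ge0P a b : 0 <= a -> 0 <= b ->
  (forall x, x <= a -> x <= b -> x <= 0) <-> orth a b.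
Proof.
move=> a0 b0; split=> [ab|ab x xa xb].
  rewrite /orth !labs_ge0_id //; apply/le_anti.
  by rewrite lexI a0 b0 !andbT; apply: ab; rewrite ?leIl ?leIr.
by apply: orth_le0 ab _ _; rewrite labs_ge0_id.
Qed.

Lemma orth_le_addl a b p x : 0 <= a -> 0 <= b -> 0 <= p -> orth a p ->
  x <= a + b -> x <= p -> x <= b.
Proof.
move=> a0 b0 p0 /(orth_ge0P a0 p0) ap xab xp.
rewrite -[b]add0r -lg_leBlD; apply: ap; first by rewrite lg_leBlD.
exact: le_trans (lg_leB x b0) xp.
Qed.

Lemma orthDl a b p : 0 <= a -> 0 <= b -> 0 <= p ->
  orth a p -> orth b p -> orth (a + b) p.
Proof.
move=> a0 b0 p0 ap /(orth_ge0P b0 p0) bp.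
apply/(orth_ge0P (lg_addr_ge0 a0 b0) p0) => x xab xp.
by apply: bp => //; apply: orth_le_addl ap xab xp.
Qed.

Lemma orth_addr_ge0 h l : orth h l -> 0 <= h + l -> 0 <= h.
Proof.
move=> hl hl0; rewrite -lg_oppr_le0; apply: orth_le0 hl (leN_labs h) _.
by apply: le_trans (le_labs l); rewrite -[- h]add0r lg_leBlD addrC.
Qed.

Lemma orth_self_eq0 p b : 0 <= b -> 0 <= p -> orth (p + b) p -> p = 0.
Proof.
move=> b0 p0 /(orth_ge0P (lg_addr_ge0 p0 b0) p0) pbp.
by apply/le_anti; rewrite p0 andbT; apply: pbp; rewrite ?lg_leDl.
Qed.

Lemma orth_mulrn_add_inj p n m a b : 0 < p -> 0 <= a -> 0 <= b ->
  orth a p -> orth b p -> p *+ n + a = p *+ m + b -> (n, a) = (m, b).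
Proof.
move=> p0; wlog le_nm : n m a b / (n <= m)%N.
  move=> IH a0 b0 ap bp e; have [nm|/ltnW mn] := leqP n m; first exact: IH.
  by apply/esym/IH.
move=> a0 b0 ap bp; rewrite -(subnKC le_nm) mulrnDr -addrA => /addrI.
case: (m - n)%N => [|k] e; first by rewrite e mulr0n add0r addn0.
move: ap; rewrite e mulrS -addrA => /orth_self_eq0 p_eq0.
by move: (p0); rewrite p_eq0 ?ltxx ?lg_addr_ge0 ?lg_mulrn_ge0 // ltW.
Qed.

Lemma int_multiples_solid_gen p x : 0 <= p ->
  int_multiples p x -> solid_gen p x.
Proof.
move=> p0 [z ->]; have p0n n : 0 <= p *+ n := lg_mulrn_ge0 n p0.
have pN n : - (p *+ n) <= p *+ n by rewrite (le_trans _ (p0n n)) ?lg_oppr_le0.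
case: z => n; [exists n | exists n.+1]; rewrite (labs_ge0_id p0) labs_le.
  by rewrite pmulrn lexx pN.
by rewrite NegzE mulrNz opprK pN lexx.
Qed.

Lemma irreducible_elt_interval p n x : irreducible_elt p ->
  0 <= x -> x <= p *+ n -> exists k, x = p *+ k.
Proof.
move=> [p0 irr]; elim: n x => [|n IH] x x0 xn.
  by exists 0%N; apply/le_anti; rewrite x0 andbT.
pose y := (x `&` p)%O.
have [y0|/eqP] : y = 0 \/ p - y = 0.
- by apply: irr; rewrite ?lg_subr_ge0 ?leIr ?lexI ?x0 ?ltW // addrC subrK.
- apply: IH => //; rewrite -[p *+ n]add0r -lg_leBlD -y0 lexI.
  by rewrite [X in _ && X]lg_leBlD -mulrS xn andbT lg_leB ?lg_mulrn_ge0 // ltW.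
rewrite subr_eq0 => /eqP py; have px : p <= x by rewrite py leIl.
have [||k xpk] := IH (x - p); rewrite ?lg_subr_ge0 // ?lg_leBlD -?mulrSr //.
by exists k.+1; rewrite mulrSr -xpk subrK.
Qed.

Lemma irreducible_elt_solid_gen p x : irreducible_elt p ->
  solid_gen p x -> int_multiples p x.
Proof.
move=> irr [n]; have p0 := ltW irr.1.
rewrite (labs_ge0_id p0) labs_le => /andP[xn Nxn].
have [||k xk] := @irreducible_elt_interval p (n + n) (x + p *+ n) irr.
- by rewrite -lg_oppr_le0 opprD lg_leBlD add0r.
- by rewrite mulrnDr lg_leD2r.
by exists (k%:Z - n%:Z); rewrite mulrzBr -!pmulrn -xk addrK.
Qed.

Lemma ordered_group_iso_int_multiples p : 0 < p ->
  ordered_group_iso (int_multiples p) int.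
Proof.
move=> p0; pose f (n : int) := p *~ n.
have fB : zmod_morphism f by move=> m n; apply: mulrzBr.
pose fA := GRing.isZmodMorphism.Build int G f fB.
pose F : {additive int -> G} := HB.pack f fA.
exists F; split=> [m n|x]; first exact: lg_ler_mulrz.
by split=> -[n ->]; exists n.
Qed.

End LatticeGroupTheory.

Theorem mainTheorem18 (G : lgroupType) (hG : dim_le1 G) (p : G) (hp : 0 < p) :
  [<-> irreducible_elt p;
       (forall x : G, solid_gen p x <-> int_multiples p x)
         /\ ordered_group_iso (int_multiples p) int;
       forall alpha : G, 0 <= alpha ->
         exists! d : nat * G,
           [/\ alpha = p *+ d.1 + d.2, 0 <= d.2 & orth d.2 p] ].
Proof.
have p0 := ltW hp.
tfae.
- move=> irr; split; last exact: ordered_group_iso_int_multiples.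
  move=> x; split; first exact: irreducible_elt_solid_gen.
  exact: int_multiples_solid_gen.
- move=> [Cp _] alpha alpha0.
  have [[_ _ dec _] orthC_p] := hG p p0.
  have [h [l [hC lC ah]]] := dec alpha.
  have hl : orth h l by apply: orthC_p.
  rewrite ah in alpha0.
  have h0 := orth_addr_ge0 hl alpha0.
  have l0 : 0 <= l.
    by move: alpha0; rewrite addrC; apply/orth_addr_ge0/orthC.
  have lp : orth l p.
    by apply/lC/int_multiples_solid_gen => //; exists 1; rewrite mulr1z.
  have /Cp[z hz] := hC.
  move: h0; rewrite hz -(mulr0z p) lg_ler_mulrz //.
  case: z hz => // k hz _; exists (k, l); split.
    by rewrite /= ah hz pmulrn.
  case=> m b /= [e b0 bp]; apply: orth_mulrn_add_inj hp l0 b0 lp bp _.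
  by rewrite -e ah hz pmulrn.
- move=> dec; split=> // eta zeta eta0 zeta0 e.
  have [[n a] [/= [etaE a0 ap] _]] := dec eta eta0.
  have [[m b] [/= [zetaE b0 bp] _]] := dec zeta zeta0.
  have op : orth (0 : G) p.
    by apply/orth_ge0P.
  have abp := orthDl a0 b0 p0 ap bp.
  have : p *+ (n + m) + (a + b) = p *+ 1 + 0.
    by rewrite mulrnDr addrACA -etaE -zetaE -e addr0.
  move/(orth_mulrn_add_inj hp (lg_addr_ge0 a0 b0) (lexx 0) abp op).
  case=> nm ab.
  have a_eq0 : a = 0 by apply/le_anti; rewrite a0 -ab lg_leDl.
  have b_eq0 : b = 0 by move: ab; rewrite a_eq0 add0r.
  rewrite etaE zetaE a_eq0 b_eq0 !addr0.
  by case: n m nm {etaE zetaE} => [|[|n]] [|m] // _; [left|right].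
Qed.
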